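(* Let $\nu_0\approx 19.6203$ be the positive root of the equation $\sqrt{\pi}\,\Gamma(\nu+3/2) = 8\,\Gamma(\nu+1)$, and let $\nu\ge\nu_0$. Let $$\mathcal{B}_{\nu}(z)= \sum_{n=0}^\infty \frac{ \Gamma(\nu+1)\,\Gamma\!\left(\frac{n+1}{2}\right)}{\sqrt{\pi}\, n!\, \Gamma\!\left(\frac{n}{2}+\nu+1\right)}\, z^n ,\qquad z\in\mathbb{D}=\{z\in\mathbb{C}:|z|<1\}.$$ Then the function $f(z)=z\mathcal{B}_\nu(z)$ is close-to-convex with respect to the starlike function $g(z)=z/(1-z^2)$.
   Context: $\mathcal{B}_\nu$ is the Bessel–Struve kernel function; $f(z)=z\mathcal{B}_\nu(z)$ satisfies $f(0)=0$, $f'(0)=1$. Given a starlike function $g$ (univalent in $\mathbb{D}$ with $g(\mathbb{D})$ starlike with respect to $0$), an analytic $f$ on $\mathbb{D}$ with $f(0)=0$, $f'(0)=1$ is close-to-convex with respect to $g$ if there exists a real $\beta$ such that $\operatorname{Re}\left(e^{i\beta}\, z f'(z)/g(z)\right)>0$ for all $z\in\mathbb{D}$. *)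

(* Defs.v *)
From Stdlib Require Import Reals Factorial.
From Coquelicot Require Import Coquelicot.
Open Scope R_scope.

Definition Gamma (x : R) : R :=
  RInt_gen (fun t => Rpower t (x - 1) * exp (- t)) (at_right 0) (Rbar_locally p_infty).

Definition bs_coef (nu : R) (n : nat) : R :=
  Gamma (nu + 1) * Gamma ((INR n + 1) / 2)
  / (sqrt PI * INR (fact n) * Gamma (INR n / 2 + nu + 1)).

Definition BS (nu : R) (z : C) : C :=
  @iota (CompleteNormedModule.CompleteSpace _ C_CompleteNormedModule) (fun l : C => is_pseries (fun n => RtoC (bs_coef nu n)) z l).

Definition inD (z : C) : Prop := Cmod z < 1.

Definition normalized_analytic (f : C -> C) : Prop :=
  (forall z, inD z -> ex_derive f z) /\ f (RtoC 0) = (RtoC 0) /\ is_derive f (RtoC 0) (RtoC 1).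

Definition starlike (g : C -> C) : Prop :=
  (forall z, inD z -> ex_derive g z) /\
  (forall z w, inD z -> inD w -> g z = g w -> z = w) /\
  (exists z, inD z /\ g z = (RtoC 0)) /\
  (forall z t, inD z -> 0 <= t <= 1 -> exists u, inD u /\ g u = Cmult (RtoC t) (g z)).

(* f close-to-convex with respect to g.  The quotient z f'(z)/g(z) has a
   removable singularity at 0; the condition is imposed at z <> 0. *)
Definition close_to_convex_wrt (f g : C -> C) : Prop :=
  normalized_analytic f /\ starlike g /\
  exists beta : R, forall z : C, inD z -> z <> (RtoC 0) ->
    forall df : C, is_derive f z df ->
    0 < Re (Cmult (cos beta, sin beta) (Cdiv (Cmult z df) (g z))).

Definition bs_f (nu : R) (z : C) : C := Cmult z (BS nu z).
Definition g_star (z : C) : C := Cdiv z (Cminus (RtoC 1) (Cmult z z)).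

(* Main.v *)
Require Import Defs.
From Stdlib Require Import Reals Lra Lia.
From Coquelicot Require Import Coquelicot.
Open Scope R_scope.

(** Take [beta = 0], so that the condition reads [Re ((1 - z^2) f'(z)) > 0].
    Since [z^2 = |z|^2 + 2 i (Im z) z], on the unit disc
      [|Re ((1 - z^2) z^n)| <= (n + 1) Re (1 - z^2)],
    and with [f'(z) = 1 + sum_(n >= 1) (n + 1) b_n z^n] it is enough that
    [sum_(n >= 1) (n + 1)^2 b_n < 1].  The functional equation gives
    [b_(n+2) = b_n / ((n + 2) (n + 2 nu + 2))], so everything reduces to
    [nu >= 15] and a bound on [b_1 = Gamma (nu + 1) / (sqrt PI Gamma (nu + 3/2))].
    Both follow from [Gamma (x + 1/2) <= sqrt x Gamma x]: at [x = nu0 + 1] it turns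
    the equation for [nu0] into [64 <= PI (nu0 + 1)], and at [x = nu + 1/2] it
    bounds [b_1]. *)

(** * The Gamma integral *)

(** The comparison must be with [Re (1 - z^2)] and not with [|1 - z^2|]: at [z = e^(i theta)] these
    are [2 sin^2 theta] and [2 |sin theta|], so their ratio degenerates near [z = 1] and [z = -1].
    The price is one more factor [n + 1], whence the weight [(n + 1)^2]; the same weight also
    controls the second-order remainder of each monomial, so one summable majorant serves both
    differentiability and positivity. [Gamma] and [BS] are defined by the total operators [RInt_gen]
    and [iota], so convergence and uniqueness have to be established before either can be computed
    with. The normalisation [b_0 = 1] rests on [Gamma (/ 2) = sqrt PI], hence the Gaussian
    integral. *)

Lemma ex_RInt_pos_axis (g : R -> R) (a b : R) :
  (forall t, 0 < t -> continuous g t) -> 0 < a -> 0 < b -> ex_RInt g a b.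
Proof.
  intros Hg Ha Hb. apply (@ex_RInt_continuous R_CompleteNormedModule).
  intros t [Ht _]. apply Hg.
  apply Rlt_le_trans with (2 := Ht). now apply Rmin_glb_lt.
Qed.

(** The limit is the supremum of the integrals over compact subintervals. The second clause keeps
    these integrals as lower bounds, which later gives positivity of [Gamma]. *)
Lemma is_RInt_gen_nonneg_bounded (g : R -> R) (M : R) :
  (forall t, 0 < t -> continuous g t) ->
  (forall t, 0 < t -> 0 <= g t) ->
  (forall a b, 0 < a <= b -> RInt g a b <= M) ->
  exists l, is_RInt_gen g (at_right 0) (Rbar_locally p_infty) l /\
    forall a b, 0 < a <= b -> RInt g a b <= l.
Proof.
  intros Hc Hp HM.
  pose (E := fun y => exists a b, 0 < a <= b /\ y = RInt g a b).
  destruct (completeness E) as [l [Hub Hlub]].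
  - exists M. intros y (a & b & Hab & ->). now apply HM.
  - exists (RInt g 1 1), 1, 1. split; [lra | reflexivity].
  - assert (Hl : forall a b, 0 < a <= b -> RInt g a b <= l).
    { intros a b Hab. apply Hub. now exists a, b. }
    exists l; split; [| exact Hl].
    intros P [eps HP].
    assert (Hex : exists a0 b0, 0 < a0 <= b0 /\ l - eps < RInt g a0 b0).
    { apply Classical_Prop.NNPP. intros Hn.
      assert (l <= l - eps); [| destruct eps; simpl in *; lra].
      apply Hlub. intros y (a & b & Hab & ->).
      apply Rnot_lt_le. intros Hlt. apply Hn. now exists a, b. }
    destruct Hex as (a0 & b0 & Hab0 & Hlt).
    (* Any interval containing [[a0, b0]] has an integral above [l - eps], the integrand being
       nonnegative, and at most [l]. *)
    exists (fun a => 0 < a < a0) (fun b => b0 < b).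
    + exists (mkposreal a0 (proj1 Hab0)). simpl. intros y Hy Hy0.
      change (Rabs (y - 0) < a0) in Hy. rewrite Rminus_0_r in Hy.
      apply Rabs_def2 in Hy. lra.
    + now exists b0.
    + intros a b Ha Hb. simpl.
      exists (RInt g a b). split.
      * apply (@RInt_correct R_CompleteNormedModule).
        apply ex_RInt_pos_axis; [exact Hc | lra | lra].
      * apply HP. change (Rabs (RInt g a b - l) < eps).
        assert (H1 := Hl a b ltac:(lra)).
        assert (Hx : forall u v, 0 < u -> 0 < v -> ex_RInt g u v)
          by (intros; now apply ex_RInt_pos_axis).
        assert (H2 : RInt g a b = RInt g a a0 + (RInt g a0 b0 + RInt g b0 b)).
        { rewrite <- (RInt_Chasles g a a0 b), <- (RInt_Chasles g a0 b0 b);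
          try apply Hx; try lra. reflexivity. }
        assert (H3 : 0 <= RInt g a a0).
        { apply RInt_ge_0; [lra | apply Hx; lra | intros; apply Hp; lra]. }
        assert (H4 : 0 <= RInt g b0 b).
        { apply RInt_ge_0; [lra | apply Hx; lra | intros; apply Hp; lra]. }
        apply Rabs_def1; lra.
Qed.

Lemma is_RInt_gen_pos_axis_le (f g : R -> R) (lf lg : R) :
  (forall t, 0 < t -> f t <= g t) ->
  is_RInt_gen f (at_right 0) (Rbar_locally p_infty) lf ->
  is_RInt_gen g (at_right 0) (Rbar_locally p_infty) lg ->
  lf <= lg.
Proof.
  intros Hfg Hf Hg. apply le_epsilon. intros e He.
  assert (He2 : 0 < e / 2) by lra.
  specialize (Hf _ (locally_ball lf (mkposreal _ He2))).
  specialize (Hg _ (locally_ball lg (mkposreal _ He2))).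
  unfold filtermapi in Hf, Hg.
  assert (Hp : filter_prod (at_right 0) (Rbar_locally p_infty)
     (fun ab : R * R => 0 < fst ab < 1 /\ 1 < snd ab)).
  { exists (fun a => 0 < a < 1) (fun b => 1 < b).
    - exists (mkposreal 1 Rlt_0_1). intros y Hy Hy0.
      change (Rabs (y - 0) < 1) in Hy. apply Rabs_def2 in Hy. lra.
    - now exists 1.
    - intros; now split. }
  destruct (filter_ex (F := filter_prod (at_right 0) (Rbar_locally p_infty)) _
     (filter_and _ _ Hp (filter_and _ _ Hf Hg)))
    as [[a b] [[Ha Hb] [[u [Hu Hlu]] [v [Hv Hlv]]]]].
  simpl in *.
  change (Rabs (u - lf) < e / 2) in Hlu. change (Rabs (v - lg) < e / 2) in Hlv.
  apply Rabs_def2 in Hlu. apply Rabs_def2 in Hlv.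
  assert (u <= v).
  { apply (is_RInt_le f g a b); try assumption; [lra |].
    intros t Ht. apply Hfg. lra. }
  lra.
Qed.

Definition Gamma_integrand (x t : R) : R := Rpower t (x - 1) * exp (- t).

Lemma Gamma_integrand_pos (x t : R) : 0 < Gamma_integrand x t.
Proof. apply Rmult_lt_0_compat; apply exp_pos. Qed.

Lemma continuous_Gamma_integrand (x t : R) : 0 < t -> continuous (Gamma_integrand x) t.
Proof.
  intros Ht. apply (@ex_derive_continuous R_AbsRing R_NormedModule).
  unfold Gamma_integrand, Rpower. auto_derive. exact Ht.
Qed.

(* From [ln u <= u - 1] at [u = t / (2 x)]. *)
Lemma Rpower_mult_exp_half_le (x t : R) :
  0 < x -> 0 < t -> Rpower t x * exp (- (t / 2)) <= Rpower (2 * x) x.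
Proof.
  intros Hx Ht. unfold Rpower. rewrite <- exp_plus.
  assert (H : ln t <= t / (2 * x) + ln (2 * x)).
  { replace t with (t / (2 * x) * (2 * x)) at 1 by (field; lra).
    assert (0 < t / (2 * x)) by (apply Rdiv_lt_0_compat; lra).
    rewrite ln_mult by lra.
    pose proof (exp_ineq1_le (ln (t / (2 * x)))) as H1.
    rewrite exp_ln in H1; lra. }
  apply (Rmult_le_compat_l x) in H; [| lra].
  replace (x * (t / (2 * x) + ln (2 * x))) with (t / 2 + x * ln (2 * x)) in H
    by (field; lra).
  destruct (Rle_lt_or_eq_dec (x * ln t + - (t / 2)) (x * ln (2 * x))) as [Hl | ->].
  - lra.
  - left. now apply exp_increasing.
  - right. reflexivity.
Qed.

(* [t^(x-1) e^(-t)] is dominated by a multiple of [t^(x-1) / (1 + t^x)^2], whose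
   antiderivative [- 1 / (x (1 + t^x))] is bounded. *)
Lemma RInt_Gamma_integrand_le (x a b : R) :
  0 < x -> 0 < a <= b ->
  RInt (Gamma_integrand x) a b <= (1 + Rpower (2 * x) x) ^ 2 / x.
Proof.
  intros Hx Hab.
  set (K := (1 + Rpower (2 * x) x) ^ 2).
  pose (H := fun t => - (K / x) / (1 + Rpower t x)).
  pose (h := fun t => K * Rpower t (x - 1) / (1 + Rpower t x) ^ 2).
  assert (HK : 0 < K).
  { apply pow_lt. pose proof (exp_pos (x * ln (2 * x))). unfold Rpower. lra. }
  assert (Hd : forall t, 0 < t -> is_derive H t (h t)).
  { intros t Ht. unfold H, h, Rpower.
    pose proof (exp_pos (x * ln t)).
    auto_derive; [repeat split; lra |].
    replace ((x - 1) * ln t) with (x * ln t + - ln t) by ring.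
    rewrite exp_plus, exp_Ropp, exp_ln by lra.
    field. repeat split; lra. }
  assert (Hch : forall t, 0 < t -> continuous h t).
  { intros t Ht. apply (@ex_derive_continuous R_AbsRing R_NormedModule).
    unfold h, Rpower. pose proof (exp_pos (x * ln t)). auto_derive.
    repeat split; try lra. nra. }
  assert (HI : is_RInt h a b (H b - H a)).
  { apply (@is_RInt_derive R_CompleteNormedModule).
    - intros t Ht. rewrite Rmin_left in Ht by lra. apply Hd. lra.
    - intros t Ht. rewrite Rmin_left in Ht by lra. apply Hch. lra. }
  apply Rle_trans with (RInt h a b).
  - apply RInt_le; [lra | | |].
    + apply ex_RInt_pos_axis; [apply continuous_Gamma_integrand | lra | lra].
    + now exists (H b - H a).
    + intros t Ht. unfold Gamma_integrand, h.
      assert (Ht0 : 0 < t) by lra.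
      pose proof (exp_pos (x * ln t)) as Hp. fold (Rpower t x) in Hp.
      pose proof (exp_pos ((x - 1) * ln t)) as Hq. fold (Rpower t (x - 1)) in Hq.
      pose proof (exp_pos (- (t / 2))) as He.
      pose proof (Rpower_mult_exp_half_le x t Hx Ht0) as Hb.
      assert (He1 : exp (- (t / 2)) <= 1).
      { rewrite <- exp_0. left. apply exp_increasing. lra. }
      (* Each half of the exponential absorbs one factor [1 + p]: [e <= 1] and
         [p * e <= Rpower (2 * x) x] give [(1 + p) * e <= 1 + Rpower (2 * x) x]. *)
      replace (- t) with (- (t / 2) + - (t / 2)) by field. rewrite exp_plus.
      set (e := exp (- (t / 2))) in *. set (p := Rpower t x) in *.
      set (q := Rpower t (x - 1)) in *.
      assert (Hs : ((1 + p) * e) ^ 2 <= K).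
      { unfold K. apply pow_incr. nra. }
      apply (Rmult_le_reg_r ((1 + p) ^ 2)); [apply pow_lt; lra |].
      replace (K * q / (1 + p) ^ 2 * (1 + p) ^ 2) with (q * K) by (field; lra).
      replace (q * (e * e) * (1 + p) ^ 2) with (q * ((1 + p) * e) ^ 2) by ring.
      apply Rmult_le_compat_l; lra.
  - rewrite (is_RInt_unique _ _ _ _ HI). unfold H.
    pose proof (exp_pos (x * ln a)) as Hpa. fold (Rpower a x) in Hpa.
    pose proof (exp_pos (x * ln b)) as Hpb. fold (Rpower b x) in Hpb.
    assert (Hkx : 0 < K / x) by (now apply Rdiv_lt_0_compat).
    set (k := K / x) in *.
    assert (0 < k / (1 + Rpower b x)) by (apply Rdiv_lt_0_compat; lra).
    assert (k / (1 + Rpower a x) <= k).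
    { apply (Rmult_le_reg_r (1 + Rpower a x)); [lra |].
      unfold Rdiv. rewrite Rmult_assoc, Rinv_l by lra. nra. }
    unfold Rdiv in *. rewrite !Ropp_mult_distr_l_reverse. lra.
Qed.

Lemma Gamma_correct (x : R) : 0 < x ->
  is_RInt_gen (Gamma_integrand x) (at_right 0) (Rbar_locally p_infty) (Gamma x) /\
  0 < Gamma x.
Proof.
  intros Hx.
  destruct (is_RInt_gen_nonneg_bounded (Gamma_integrand x)
              ((1 + Rpower (2 * x) x) ^ 2 / x)) as (l & Hl & Hle).
  - apply continuous_Gamma_integrand.
  - intros t _. left. apply Gamma_integrand_pos.
  - intros a b Hab. now apply RInt_Gamma_integrand_le.
  - assert (Hg : Gamma x = l).
    { exact (is_RInt_gen_unique (V := R_CompleteNormedModule) _ _ Hl). }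
    rewrite Hg. split; [exact Hl |].
    apply Rlt_le_trans with (2 := Hle 1 2 ltac:(lra)).
    apply RInt_gt_0; [lra | intros; apply Gamma_integrand_pos |].
    intros t Ht. apply continuous_Gamma_integrand. lra.
Qed.

(* Unlike Coquelicot's [is_RInt_gen_Derive], the integrand only has to agree
   with a derivative on the positive axis. *)
Lemma is_RInt_gen_pos_axis_derive (F f : R -> R) (la lb : R) :
  (forall t, 0 < t -> is_derive F t (f t)) ->
  (forall t, 0 < t -> continuous f t) ->
  filterlim F (at_right 0) (locally la) ->
  filterlim F (Rbar_locally p_infty) (locally lb) ->
  is_RInt_gen f (at_right 0) (Rbar_locally p_infty) (lb - la).
Proof.
  intros Hd Hc Ha Hb.
  assert (Hpos : filter_prod (at_right 0) (Rbar_locally p_infty)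
     (fun ab : R * R => 0 < Rmin (fst ab) (snd ab))).
  { exists (fun a => 0 < a) (fun b => 0 < b).
    - exists (mkposreal 1 Rlt_0_1). now intros.
    - now exists 0.
    - intros a b H1 H2. now apply Rmin_glb_lt. }
  apply is_RInt_gen_ext with (Derive F).
  - revert Hpos. apply filter_imp. intros [a b] Hab t [Ht _]. simpl in *.
    apply is_derive_unique, Hd. lra.
  - apply is_RInt_gen_Derive; [| | exact Ha | exact Hb].
    + revert Hpos. apply filter_imp. intros [a b] Hab t [Ht _]. simpl in *.
      exists (f t). apply Hd. lra.
    + revert Hpos. apply filter_imp. intros [a b] Hab t [Ht _]. simpl in *.
      assert (Ht0 : 0 < t) by lra.
      apply continuous_ext_loc with f; [| now apply Hc].
      exists (mkposreal t Ht0). intros y Hy. change (Rabs (y - t) < t) in Hy.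
      apply Rabs_def2 in Hy. symmetry. apply is_derive_unique, Hd. lra.
Qed.

Lemma Gamma_1 : Gamma 1 = 1.
Proof.
  replace 1 with (0 - - 1) at 2 by ring.
  refine (is_RInt_gen_unique (V := R_CompleteNormedModule) _ _ (_ : is_RInt_gen (Gamma_integrand 1) _ _ _)).
  apply (is_RInt_gen_pos_axis_derive (fun t => - exp (- t))).
  - intros t Ht. unfold Gamma_integrand.
    rewrite Rminus_diag, Rpower_O by exact Ht.
    auto_derive; [exact I | ring].
  - apply continuous_Gamma_integrand.
  - replace (- 1) with (- exp (- 0)) by (rewrite Ropp_0, exp_0; ring).
    eapply filterlim_filter_le_1; [apply filter_le_within |].
    apply (@ex_derive_continuous R_AbsRing R_NormedModule (fun t => - exp (- t))).
    auto_derive. exact I.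
  - assert (L : is_lim (fun t => - exp (- t)) p_infty 0).
    { replace (Finite 0) with (Rbar_opp 0) by (simpl; now rewrite Ropp_0).
      apply is_lim_opp.
      apply (is_lim_comp exp Ropp p_infty 0 m_infty).
      - apply is_lim_exp_m.
      - apply (is_lim_opp (fun t => t) p_infty p_infty). apply is_lim_id.
      - now exists 0. }
    exact L.
Qed.

Lemma filterlim_Rpower_0_right (x : R) :
  0 < x -> filterlim (fun t => Rpower t x) (at_right 0) (locally 0).
Proof.
  intros Hx. unfold Rpower.
  apply filterlim_comp with (Rbar_locally m_infty).
  - apply filterlim_comp with (Rbar_locally m_infty); [apply is_lim_ln_0 |].
    intros P [M HM]. exists (M / x). intros y Hy. apply HM.
    apply (Rmult_lt_compat_l x) in Hy; [| lra].
    replace (x * (M / x)) with M in Hy by (field; lra). exact Hy.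
  - apply is_lim_exp_m.
Qed.

(** Integration by parts: [t^x e^(-t)] has derivative [x t^(x-1) e^(-t) - t^x e^(-t)] and vanishes
    at both ends. *)
Lemma Gamma_succ (x : R) : 0 < x -> Gamma (x + 1) = x * Gamma x.
Proof.
  intros Hx.
  destruct (Gamma_correct x Hx) as [H0 _].
  destruct (Gamma_correct (x + 1) ltac:(lra)) as [H1 _].
  pose (F := fun t => Rpower t x * exp (- t)).
  assert (HF : is_RInt_gen (fun t => x * Gamma_integrand x t - Gamma_integrand (x + 1) t)
             (at_right 0) (Rbar_locally p_infty) (0 - 0)).
  { apply (is_RInt_gen_pos_axis_derive F).
    - intros t Ht. unfold F, Gamma_integrand, Rpower.
      auto_derive; [exact Ht |].
      replace ((x + 1 - 1) * ln t) with (x * ln t) by ring.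
      replace ((x - 1) * ln t) with (x * ln t + - ln t) by ring.
      rewrite exp_plus, (exp_Ropp (ln t)), exp_ln by lra. field. lra.
    - intros t Ht. apply (@ex_derive_continuous R_AbsRing R_NormedModule).
      unfold Gamma_integrand, Rpower. auto_derive. split; [exact Ht | split; [exact Ht | exact I]].
    - apply filterlim_locally. intros eps.
      generalize (proj1 (filterlim_locally _ _) (filterlim_Rpower_0_right x Hx) eps).
      unfold at_right, within. apply filter_imp. intros t Ht Ht0.
      specialize (Ht Ht0).
      change (Rabs (Rpower t x - 0) < eps) in Ht. change (Rabs (F t - 0) < eps).
      unfold F. rewrite Rminus_0_r in *. rewrite Rabs_mult.
      apply Rle_lt_trans with (2 := Ht).
      rewrite <- (Rmult_1_r (Rabs (Rpower t x))) at 2.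
      apply Rmult_le_compat_l; [apply Rabs_pos |].
      rewrite Rabs_pos_eq by (left; apply exp_pos).
      rewrite <- exp_0. left. apply exp_increasing. lra.
    - apply filterlim_locally. intros eps.
      set (K := Rpower (2 * x) x).
      assert (HK : 0 < K) by apply exp_pos.
      assert (Heps : 0 < 2 * K / eps).
      { apply Rdiv_lt_0_compat; [lra | apply cond_pos]. }
      (* Since [F t <= K e^(-t/2)] and [e^(t/2) > t/2], it is enough that [K < eps * (t / 2)]. *)
      exists (2 * K / eps). intros t Ht.
      assert (Ht0 : 0 < t) by lra.
      change (Rabs (F t - 0) < eps). rewrite Rminus_0_r.
      rewrite Rabs_pos_eq by (left; apply Rmult_lt_0_compat; apply exp_pos).
      unfold F. replace (- t) with (- (t / 2) + - (t / 2)) by field.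
      rewrite exp_plus, <- Rmult_assoc.
      apply Rle_lt_trans with (K * exp (- (t / 2))).
      + apply Rmult_le_compat_r; [left; apply exp_pos |].
        now apply Rpower_mult_exp_half_le.
      + rewrite exp_Ropp.
        pose proof (exp_ineq1 (t / 2) ltac:(lra)) as He.
        apply (Rmult_lt_reg_r (exp (t / 2))); [apply exp_pos |].
        rewrite Rmult_assoc, Rinv_l, Rmult_1_r by (apply Rgt_not_eq, exp_pos).
        apply Rlt_trans with (eps * (t / 2)).
        * apply (Rmult_lt_compat_l eps) in Ht; [| apply cond_pos].
          replace (eps * (2 * K / eps)) with (2 * K) in Ht
            by (field; apply Rgt_not_eq, cond_pos).
          lra.
        * apply Rmult_lt_compat_l; [apply cond_pos | lra]. }
  assert (HG := is_RInt_gen_minus _ _ _ _ (is_RInt_gen_scal _ x _ H0) H1).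
  apply (is_RInt_gen_unique (V := R_CompleteNormedModule)) in HF.
  apply (is_RInt_gen_unique (V := R_CompleteNormedModule)) in HG.
  change (RInt_gen (fun t => x * Gamma_integrand x t - Gamma_integrand (x + 1) t)
             (at_right 0) (Rbar_locally p_infty) = x * Gamma x - Gamma (x + 1)) in HG.
  lra.
Qed.

(* Integrate [2 sqrt x t^(x-1/2) <= t^x + x t^(x-1)], which is AM-GM. *)
Lemma Gamma_half_shift_le (x : R) : 0 < x -> Gamma (x + / 2) <= sqrt x * Gamma x.
Proof.
  intros Hx.
  destruct (Gamma_correct x Hx) as [H0 _].
  destruct (Gamma_correct (x + / 2) ltac:(lra)) as [Hh _].
  destruct (Gamma_correct (x + 1) ltac:(lra)) as [H1 _].
  assert (Hs : 0 < sqrt x) by (now apply sqrt_lt_R0).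
  assert (Hss : sqrt x * sqrt x = x) by (apply sqrt_sqrt; lra).
  assert (HL := is_RInt_gen_scal _ (2 * sqrt x) _ Hh).
  assert (HR := is_RInt_gen_plus _ _ _ _ H1 (is_RInt_gen_scal _ x _ H0)).
  assert (Hpt : forall t, 0 < t -> 2 * sqrt x * Gamma_integrand (x + / 2) t
          <= Gamma_integrand (x + 1) t + x * Gamma_integrand x t).
  { intros t Ht.
    unfold Gamma_integrand.
    replace (x + / 2 - 1) with (x - 1 + / 2) by ring.
    replace (x + 1 - 1) with (x - 1 + 1) by ring.
    rewrite !Rpower_plus, Rpower_1, Rpower_sqrt by exact Ht.
    pose proof (exp_pos (- t)) as He.
    pose proof (exp_pos ((x - 1) * ln t)) as Hq. fold (Rpower t (x - 1)) in Hq.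
    assert (Hst : sqrt t * sqrt t = t) by (apply sqrt_sqrt; lra).
    set (q := Rpower t (x - 1)) in *. set (e := exp (- t)) in *.
    assert (Hqe : 0 < q * e) by (now apply Rmult_lt_0_compat).
    assert (0 <= q * e * (t + x - 2 * sqrt x * sqrt t)); [| nra].
    apply Rmult_le_pos; [lra |]. pose proof (Rle_0_sqr (sqrt t - sqrt x)).
    unfold Rsqr in *. nra. }
  assert (Hle := is_RInt_gen_pos_axis_le _ _ _ _ Hpt HL HR).
  change (2 * sqrt x * Gamma (x + / 2) <= Gamma (x + 1) + x * Gamma x) in Hle.
  rewrite Gamma_succ in Hle by exact Hx.
  apply (Rmult_le_reg_l (2 * sqrt x)); [lra |]. nra.
Qed.

(** * The Gaussian integral *)

Definition gauss_int (x : R) : R := RInt (fun s => exp (- s ^ 2)) 0 x.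

(* [gauss_int x ^ 2 + gauss_aux x] is constant, which evaluates the limit of [gauss_int]. *)
Definition gauss_aux (x : R) : R :=
  RInt (fun t => exp (- (x ^ 2 * (1 + t ^ 2))) / (1 + t ^ 2)) 0 1.

Lemma continuous_gauss (s : R) : continuous (fun s => exp (- s ^ 2)) s.
Proof.
  apply (@ex_derive_continuous R_AbsRing R_NormedModule). auto_derive. exact I.
Qed.

Lemma is_derive_gauss_int (x : R) : is_derive gauss_int x (exp (- x ^ 2)).
Proof.
  apply (is_derive_RInt (fun s => exp (- s ^ 2)) gauss_int 0 x).
  - apply filter_forall. intros y. apply (@RInt_correct R_CompleteNormedModule).
    apply (@ex_RInt_continuous R_CompleteNormedModule). intros; apply continuous_gauss.
  - apply continuous_gauss.
Qed.

(** Differentiating under the integral cancels [1 + t^2]; then [e^(-x^2)] factors out and the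
    substitution [s = x t] leaves [gauss_int x]. The result is minus the derivative of
    [gauss_int x ^ 2]. *)
Lemma is_derive_gauss_aux (x : R) :
  is_derive gauss_aux x (- 2 * exp (- x ^ 2) * gauss_int x).
Proof.
  assert (Hp : forall t, 0 < 1 + t ^ 2) by (intros t; pose proof (pow2_ge_0 t); lra).
  pose (f := fun x t => exp (- (x ^ 2 * (1 + t ^ 2))) / (1 + t ^ 2)).
  assert (Hf : forall u v : R, is_derive (fun z : R => f z v) u
                 ((- 2 * u) * exp (- (u ^ 2 * (1 + v ^ 2))))).
  { intros u v. unfold f. specialize (Hp v). auto_derive; [lra |].
    change (u * (u * 1)) with (u ^ 2). change (v * (v * 1)) with (v ^ 2). field. lra. }
  assert (Hcomp : RInt (fun t => Derive (fun u => f u t) x) 0 1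
                  = - 2 * exp (- x ^ 2) * gauss_int x).
  (* The [+ 0] puts the integrand in the affine form expected by [RInt_comp_lin]. *)
  { rewrite (RInt_ext _ (fun t => (- 2 * exp (- x ^ 2)) * (x * exp (- (x * t + 0) ^ 2)))).
    2: { intros t _. rewrite (is_derive_unique (fun u : R => f u t) x _ (Hf x t)).
         replace (- (x ^ 2 * (1 + t ^ 2))) with (- x ^ 2 + - (x * t + 0) ^ 2) by ring.
         rewrite exp_plus.
         match goal with |- @eq _ ?a ?b => change (@eq R a b) end. ring. }
    assert (Hlin : RInt (fun t => x * exp (- (x * t + 0) ^ 2)) 0 1 = gauss_int x).
    { transitivity (RInt (fun s => exp (- s ^ 2)) (x * 0 + 0) (x * 1 + 0)).
      - apply (RInt_comp_lin (V := R_CompleteNormedModule) (fun s => exp (- s ^ 2))).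
        apply (@ex_RInt_continuous R_CompleteNormedModule). intros; apply continuous_gauss.
      - replace (x * 0 + 0) with 0 by ring. replace (x * 1 + 0) with x by ring.
        reflexivity. }
    rewrite <- Hlin.
    apply (RInt_scal (V := R_CompleteNormedModule) (fun t => x * exp (- (x * t + 0) ^ 2))).
    apply (@ex_RInt_continuous R_CompleteNormedModule). intros t _.
    apply (@ex_derive_continuous R_AbsRing R_NormedModule). auto_derive. exact I. }
  rewrite <- Hcomp.
  apply (is_derive_RInt_param f).
  - apply filter_forall. intros y t _. eexists. apply Hf.
  - intros t _.
    apply continuity_2d_pt_ext with (fun u v => (- 2 * u) * exp (- (u ^ 2 * (1 + v ^ 2)))).
    { intros u v. symmetry. apply is_derive_unique, Hf. }
    apply continuity_2d_pt_mult.
    + apply continuity_2d_pt_mult; [apply continuity_2d_pt_const | apply continuity_2d_pt_id1].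
    + apply (continuity_1d_2d_pt_comp exp); [apply derivable_continuous_pt, derivable_pt_exp |].
      apply continuity_2d_pt_opp, continuity_2d_pt_mult.
      * apply (continuity_1d_2d_pt_comp (fun u => u ^ 2)); [| apply continuity_2d_pt_id1].
        apply derivable_continuous_pt, derivable_pt_pow.
      * apply continuity_2d_pt_plus; [apply continuity_2d_pt_const |].
        apply (continuity_1d_2d_pt_comp (fun u => u ^ 2)); [| apply continuity_2d_pt_id2].
        apply derivable_continuous_pt, derivable_pt_pow.
  - apply filter_forall. intros y. apply (@ex_RInt_continuous R_CompleteNormedModule).
    intros t _. apply (@ex_derive_continuous R_AbsRing R_NormedModule).
    unfold f. specialize (Hp t). auto_derive. lra.
Qed.

Lemma gauss_aux_0 : gauss_aux 0 = PI / 4.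
Proof.
  replace (PI / 4) with (atan 1 - atan 0) by (rewrite atan_1, atan_0; ring).
  apply is_RInt_unique.
  apply (@is_RInt_derive R_CompleteNormedModule atan).
  - intros t _. rewrite pow_i, Rmult_0_l, Ropp_0, exp_0 by lia.
    apply is_derive_Reals. replace (1 / (1 + t ^ 2)) with (/ (1 + t ^ 2)) by (unfold Rdiv; ring).
    apply derivable_pt_lim_atan.
  - intros t _. apply (@ex_derive_continuous R_AbsRing R_NormedModule).
    pose proof (pow2_ge_0 t). auto_derive. lra.
Qed.

Lemma gauss_int_sqr (x : R) : 0 <= x -> gauss_int x ^ 2 = PI / 4 - gauss_aux x.
Proof.
  intros [Hx | <-].
  - assert (H : gauss_int 0 ^ 2 + gauss_aux 0 = gauss_int x ^ 2 + gauss_aux x).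
    { apply (eq_is_derive (fun x => gauss_int x ^ 2 + gauss_aux x)); [| exact Hx].
      intros t _.
      pose proof (is_derive_plus _ _ _ _ _
        (is_derive_mult _ _ _ _ _ (is_derive_gauss_int t) (is_derive_gauss_int t) Rmult_comm)
        (is_derive_gauss_aux t)) as H.
      apply (is_derive_ext (fun t : R => gauss_int t * gauss_int t + gauss_aux t));
        [intros s; change (gauss_int s * gauss_int s + gauss_aux s = gauss_int s ^ 2 + gauss_aux s); ring |].
      match type of H with is_derive _ _ ?l => replace (@zero R_NormedModule) with l end; [exact H |].
      unfold plus, mult, zero; simpl. ring. }
    rewrite gauss_aux_0 in H. unfold gauss_int at 1 in H. rewrite RInt_point in H.
    change (@zero _) with 0 in H. lra.
  - rewrite gauss_aux_0. unfold gauss_int. rewrite RInt_point.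
    change (@zero _) with 0. ring.
Qed.

Lemma gauss_aux_bounds (x : R) : 0 <= gauss_aux x <= exp (- x ^ 2).
Proof.
  assert (Hp : forall t, 1 <= 1 + t ^ 2) by (intros t; pose proof (pow2_ge_0 t); lra).
  assert (Hex : ex_RInt (fun t => exp (- (x ^ 2 * (1 + t ^ 2))) / (1 + t ^ 2)) 0 1).
  { apply (@ex_RInt_continuous R_CompleteNormedModule).
    intros t _. apply (@ex_derive_continuous R_AbsRing R_NormedModule).
    specialize (Hp t). auto_derive. lra. }
  split.
  - apply RInt_ge_0; [lra | exact Hex |]. intros t _. specialize (Hp t).
    left. apply Rdiv_lt_0_compat; [apply exp_pos | lra].
  - replace (exp (- x ^ 2)) with (RInt (fun _ => exp (- x ^ 2)) 0 1).
    2: { rewrite RInt_const. unfold scal; simpl; unfold mult; simpl. ring. }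
    apply RInt_le; [lra | exact Hex | apply ex_RInt_const |].
    intros t _. specialize (Hp t).
    apply (Rmult_le_reg_r (1 + t ^ 2)); [lra |].
    unfold Rdiv. rewrite Rmult_assoc, Rinv_l, Rmult_1_r by lra.
    apply Rle_trans with (exp (- x ^ 2)).
    + destruct (Req_dec (x ^ 2 * (1 + t ^ 2)) (x ^ 2)) as [-> | Hne]; [lra |].
      left. apply exp_increasing. pose proof (pow2_ge_0 x). nra.
    + pose proof (exp_pos (- x ^ 2)). nra.
Qed.

Lemma gauss_int_lim : filterlim gauss_int (Rbar_locally p_infty) (locally (sqrt PI / 2)).
Proof.
  assert (HG : is_lim gauss_aux p_infty 0).
  { apply (is_lim_le_le_loc (fun _ => 0) (fun x => / x)).
    - exists 1. intros x Hx. destruct (gauss_aux_bounds x) as [H1 H2].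
      split; [exact H1 |]. apply Rle_trans with (1 := H2).
      rewrite exp_Ropp. apply Rinv_le_contravar; [lra |].
      pose proof (exp_ineq1_le (x ^ 2)). nra.
    - apply is_lim_const.
    - apply (is_lim_inv (fun x => x) p_infty p_infty); [apply is_lim_id | easy]. }
  assert (Hs : sqrt PI / 2 = sqrt (PI / 4 - 0)).
  { rewrite Rminus_0_r. symmetry. pose proof PI_RGT_0. apply sqrt_lem_1.
    - lra.
    - pose proof (sqrt_pos PI). lra.
    - replace (sqrt PI / 2 * (sqrt PI / 2)) with (sqrt PI * sqrt PI / 4) by field.
      rewrite sqrt_sqrt by lra. reflexivity. }
  rewrite Hs.
  apply filterlim_ext_loc with (fun x => sqrt (PI / 4 - gauss_aux x)).
  - exists 0. intros x Hx. rewrite <- gauss_int_sqr by lra. apply sqrt_pow2.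
    apply RInt_ge_0; [lra | | intros; left; apply exp_pos].
    apply (@ex_RInt_continuous R_CompleteNormedModule). intros; apply continuous_gauss.
  - apply (filterlim_comp _ _ _ (fun x => PI / 4 - gauss_aux x) sqrt _ (locally (PI / 4 - 0))).
    + exact (is_lim_minus' (fun _ => PI / 4) gauss_aux p_infty (PI / 4) 0
               (is_lim_const _ _) HG).
    + apply continuous_sqrt.
Qed.

(* [2 gauss_int (sqrt t)] is an antiderivative of the integrand. *)
Lemma Gamma_half : Gamma (/ 2) = sqrt PI.
Proof.
  replace (sqrt PI) with (2 * (sqrt PI / 2) - 2 * 0) by field.
  refine (is_RInt_gen_unique (V := R_CompleteNormedModule) _ _
            (_ : is_RInt_gen (Gamma_integrand (/ 2)) _ _ _)).
  apply (is_RInt_gen_pos_axis_derive (fun t => 2 * gauss_int (sqrt t))).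
  - intros t Ht.
    assert (Hs : 0 < sqrt t) by (now apply sqrt_lt_R0).
    replace (Gamma_integrand (/ 2) t)
      with (scal 2 (scal (/ (2 * sqrt t)) (exp (- (sqrt t) ^ 2)))).
    + apply is_derive_scal. apply (is_derive_comp gauss_int sqrt).
      * apply is_derive_gauss_int.
      * apply is_derive_Reals, derivable_pt_lim_sqrt, Ht.
    + unfold Gamma_integrand. rewrite pow2_sqrt by lra.
      replace (/ 2 - 1) with (- / 2) by field.
      rewrite Rpower_Ropp, Rpower_sqrt by exact Ht.
      unfold scal; simpl; unfold mult; simpl. field. lra.
  - apply continuous_Gamma_integrand.
  - apply (filterlim_comp _ _ _ (fun t => gauss_int (sqrt t)) (fun y => 2 * y) _ (locally 0)).
    + eapply filterlim_filter_le_1; [apply filter_le_within |].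
      replace 0 with (gauss_int (sqrt 0)) at 2.
      2: { rewrite sqrt_0. exact (RInt_point (V := R_CompleteNormedModule) 0 _). }
      apply (continuous_comp sqrt gauss_int).
      * apply continuous_sqrt.
      * apply (@ex_derive_continuous R_AbsRing R_NormedModule).
        eexists. apply is_derive_gauss_int.
    + apply (filterlim_scal_r 2 0).
  - apply (filterlim_comp _ _ _ (fun t => gauss_int (sqrt t)) (fun y => 2 * y)
             _ (locally (sqrt PI / 2))).
    + apply filterlim_comp with (Rbar_locally p_infty); [apply filterlim_sqrt_p |].
      apply gauss_int_lim.
    + apply (filterlim_scal_r 2 (sqrt PI / 2)).
Qed.

(** * The Bessel-Struve coefficients *)

Lemma bs_coef_pos (nu : R) (n : nat) : 0 < nu -> 0 < bs_coef nu n.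
Proof.
  intros Hnu. pose proof (pos_INR n) as Hn. unfold bs_coef.
  apply Rdiv_lt_0_compat.
  - apply Rmult_lt_0_compat; apply Gamma_correct; lra.
  - apply Rmult_lt_0_compat; [apply Rmult_lt_0_compat |].
    + apply sqrt_lt_R0, PI_RGT_0.
    + apply INR_fact_lt_0.
    + apply Gamma_correct. lra.
Qed.

Lemma bs_coef_0 (nu : R) : 0 < nu -> bs_coef nu 0 = 1.
Proof.
  intros Hnu. unfold bs_coef. simpl INR.
  replace ((0 + 1) / 2) with (/ 2) by field.
  replace (0 / 2 + nu + 1) with (nu + 1) by field.
  rewrite Gamma_half.
  destruct (Gamma_correct (nu + 1) ltac:(lra)) as [_ H].
  pose proof (sqrt_lt_R0 PI PI_RGT_0). simpl. field. lra.
Qed.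

(** The Gamma arguments move by one half per index, so the functional equation links indices two
    apart. Its factor [(n + 1) / 2] cancels the [n + 1] of the factorial. *)
Lemma bs_coef_SS (nu : R) (n : nat) : 0 < nu ->
  bs_coef nu (S (S n)) = bs_coef nu n / ((INR n + 2) * (INR n + 2 * nu + 2)).
Proof.
  intros Hnu. pose proof (pos_INR n) as Hn. unfold bs_coef.
  rewrite !fact_simpl, !mult_INR, !S_INR.
  replace ((INR n + 1 + 1 + 1) / 2) with ((INR n + 1) / 2 + 1) by field.
  replace ((INR n + 1 + 1) / 2 + nu + 1) with (INR n / 2 + nu + 1 + 1) by field.
  rewrite (Gamma_succ ((INR n + 1) / 2)), (Gamma_succ (INR n / 2 + nu + 1)) by lra.
  destruct (Gamma_correct (INR n / 2 + nu + 1) ltac:(lra)) as [_ H].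
  pose proof (sqrt_lt_R0 PI PI_RGT_0). pose proof (INR_fact_lt_0 n).
  field. repeat split; lra.
Qed.

Lemma Gamma_ratio_root_ge (nu0 : R) :
  0 < nu0 -> sqrt PI * Gamma (nu0 + 3 / 2) = 8 * Gamma (nu0 + 1) ->
  64 <= PI * (nu0 + 1).
Proof.
  intros H0 Heq.
  pose proof (Gamma_half_shift_le (nu0 + 1) ltac:(lra)) as Hle.
  replace (nu0 + 1 + / 2) with (nu0 + 3 / 2) in Hle by field.
  destruct (Gamma_correct (nu0 + 1) ltac:(lra)) as [_ HG].
  pose proof (sqrt_lt_R0 PI PI_RGT_0) as Hpi.
  pose proof (sqrt_lt_R0 (nu0 + 1) ltac:(lra)) as Hs.
  assert (H8 : 8 <= sqrt PI * sqrt (nu0 + 1)).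
  { apply (Rmult_le_reg_r (Gamma (nu0 + 1))); [exact HG |].
    rewrite <- Heq, Rmult_assoc. apply Rmult_le_compat_l; lra. }
  rewrite <- (sqrt_sqrt PI), <- (sqrt_sqrt (nu0 + 1)) by (pose proof PI_RGT_0; lra).
  nra.
Qed.

(** The half-step inequality, with [Gamma (nu + 3/2) = (nu + 1/2) Gamma (nu + 1/2)], yields
    [b_1 <= 1 / sqrt (PI (nu + 1/2))]. Passing from [nu + 1] to [nu + 1/2] spoils the bound [1/8];
    the weaker [9/64 = (3/8)^2] leaves room for this loss. *)
Lemma bs_coef_1_le (nu : R) : 64 <= PI * (nu + 1) -> bs_coef nu 1 <= 9 / 64.
Proof.
  intros H64. pose proof PI_RGT_0. pose proof PI_4.
  assert (Hnu : 15 <= nu) by nra.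
  unfold bs_coef. change (Factorial.fact 1) with 1%nat. simpl INR.
  replace ((1 + 1) / 2) with 1 by field.
  replace (1 / 2 + nu + 1) with (nu + / 2 + 1) by field.
  rewrite Gamma_1, (Gamma_succ (nu + / 2)) by lra.
  pose proof (Gamma_half_shift_le (nu + / 2) ltac:(lra)) as Hle.
  replace (nu + / 2 + / 2) with (nu + 1) in Hle by field.
  destruct (Gamma_correct (nu + / 2) ltac:(lra)) as [_ HG].
  pose proof (sqrt_lt_R0 PI PI_RGT_0) as Hpi.
  pose proof (sqrt_lt_R0 (nu + / 2) ltac:(lra)) as Hs.
  assert (Hss : sqrt (nu + / 2) * sqrt (nu + / 2) = nu + / 2) by (apply sqrt_sqrt; lra).
  assert (Hpp : sqrt PI * sqrt PI = PI) by (apply sqrt_sqrt; lra).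
  rewrite <- Hss at 1.
  set (s := sqrt (nu + / 2)) in *. set (p := sqrt PI) in *.
  (* [PI (nu + 1/2) >= 64 - PI / 2 >= 62], which exceeds [(64/9)^2], about 50.6. *)
  assert (Hps : 64 / 9 <= p * s).
  { apply Rnot_lt_le. intros Hlt.
    assert (0 < p * s) by (now apply Rmult_lt_0_compat).
    assert ((p * s) * (p * s) = PI * (nu + / 2)) by (rewrite <- Hpp, <- Hss; ring).
    nra. }
  assert (0 < s * Gamma (nu + / 2)) by (now apply Rmult_lt_0_compat).
  apply Rle_trans with (s * Gamma (nu + / 2) * 1 / (p * 1 * (s * s * Gamma (nu + / 2)))).
  - apply Rmult_le_compat_r; [| lra]. left. apply Rinv_0_lt_compat.
    repeat apply Rmult_lt_0_compat; lra.
  - replace (s * Gamma (nu + / 2) * 1 / (p * 1 * (s * s * Gamma (nu + / 2))))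
      with (/ (p * s)) by (field; repeat split; lra).
    replace (9 / 64) with (/ (64 / 9)) by field.
    apply Rinv_le_contravar; lra.
Qed.

(** Two index steps contract by [9/64 = (3/8)^2]: the weight grows by at most 9, as
    [n + 3 <= 3 (n + 1)], and the recurrence divides by [(n + 2) (n + 2 nu + 2) >= 64]. The factor
    [3/2] is fitted to [n = 1], where [4 * 9/64 = 3/2 * 3/8]. *)
Lemma bs_coef_geom_le (nu : R) (n : nat) :
  64 <= PI * (nu + 1) -> (INR n + 1) ^ 2 * bs_coef nu n <= 3 / 2 * (3 / 8) ^ n.
Proof.
  intros H64. pose proof PI_RGT_0. pose proof PI_4.
  assert (Hnu : 15 <= nu) by nra.
  (* The recurrence skips one index, so the induction carries two consecutive bounds. *)
  enough (Hpair : (INR n + 1) ^ 2 * bs_coef nu n <= 3 / 2 * (3 / 8) ^ n /\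
    (INR (S n) + 1) ^ 2 * bs_coef nu (S n) <= 3 / 2 * (3 / 8) ^ S n) by apply Hpair.
  induction n as [| n [IH1 IH2]].
  - rewrite bs_coef_0 by lra. pose proof (bs_coef_1_le nu H64). simpl. lra.
  - split; [exact IH2 |].
    rewrite bs_coef_SS by lra. rewrite !S_INR.
    pose proof (pos_INR n) as Hn. pose proof (bs_coef_pos nu n ltac:(lra)) as Hb.
    set (x := INR n) in *. set (b := bs_coef nu n) in *.
    apply Rle_trans with (9 / 64 * ((x + 1) ^ 2 * b)).
    2: { simpl pow. simpl pow in IH1. lra. }
    assert (Hden : 0 < (x + 2) * (x + 2 * nu + 2)) by (apply Rmult_lt_0_compat; lra).
    apply (Rmult_le_reg_r ((x + 2) * (x + 2 * nu + 2))); [exact Hden |].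
    replace ((x + 1 + 1 + 1) ^ 2 * (b / ((x + 2) * (x + 2 * nu + 2))) *
      ((x + 2) * (x + 2 * nu + 2))) with (b * (x + 3) ^ 2) by (field; lra).
    replace (9 / 64 * ((x + 1) ^ 2 * b) * ((x + 2) * (x + 2 * nu + 2)))
      with (b * ((3 * (x + 1)) ^ 2 * ((x + 2) * (x + 2 * nu + 2) / 64))) by field.
    apply Rmult_le_compat_l; [lra |].
    rewrite <- (Rmult_1_r ((x + 3) ^ 2)).
    apply Rmult_le_compat; [apply pow2_ge_0 | lra | | nra].
    apply pow_incr. lra.
Qed.

(** * Starlikeness of [z / (1 - z^2)] *)

(** A quadratic remainder bound reduces complex differentiability to a norm estimate; it is applied
    to [g_star] and to [bs_f]. *)
Lemma is_derive_C_quadratic (f : C -> C) (z l : C) (delta K : R) :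
  0 < delta -> 0 <= K ->
  (forall w, Cmod (w - z) < delta ->
     Cmod (f w - f z - (w - z) * l)%C <= K * Cmod (w - z) ^ 2) ->
  @is_derive C_AbsRing C_NormedModule f z l.
Proof.
  intros Hd HK H. split; [apply (is_linear_scal_l (K := C_AbsRing) (V := C_NormedModule)) |].
  intros x Hx eps.
  apply (is_filter_lim_locally_unique (K := C_AbsRing) (V := AbsRing_NormedModule C_AbsRing)) in Hx.
  rewrite <- Hx.
  (* Dividing by [K + 1] covers the case [K = 0]. *)
  assert (He : 0 < Rmin delta (eps / (K + 1))).
  { apply Rmin_glb_lt; [exact Hd |]. apply Rdiv_lt_0_compat; [apply cond_pos | lra]. }
  exists (mkposreal _ He). intros w Hw.
  change (Cmod (w - z) < Rmin delta (eps / (K + 1))) in Hw.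
  change (Cmod (f w - f z - (w - z) * l)%C <= eps * Cmod (w - z)).
  apply Rle_trans with (K * Cmod (w - z) ^ 2).
  - apply H. apply Rlt_le_trans with (1 := Hw). apply Rmin_l.
  - assert (Hw2 : Cmod (w - z) < eps / (K + 1)).
    { apply Rlt_le_trans with (1 := Hw). apply Rmin_r. }
    apply (Rmult_lt_compat_r (K + 1)) in Hw2; [| lra].
    unfold Rdiv in Hw2. rewrite Rmult_assoc, Rinv_l in Hw2 by lra.
    pose proof (Cmod_ge_0 (w - z)). nra.
Qed.

Lemma Cmod_lt_1_sqr (z : C) : Cmod z < 1 -> Re z ^ 2 + Im z ^ 2 < 1.
Proof.
  intros Hz. rewrite <- Cmod2_alt. pose proof (Cmod_ge_0 z). nra.
Qed.

Lemma one_minus_sqr_ge (z : C) : 1 - Cmod z ^ 2 <= Cmod (1 - z * z).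
Proof.
  pose proof (Cmod_triangle (1 - z * z) (z * z)) as H.
  replace (1 - z * z + z * z)%C with (RtoC 1) in H by ring.
  rewrite Cmod_1, Cmod_mult in H. lra.
Qed.

Lemma one_minus_sqr_neq_0 (z : C) : inD z -> (1 - z * z)%C <> 0.
Proof.
  intros Hz. apply Cmod_gt_0. unfold inD in Hz.
  pose proof (one_minus_sqr_ge z). pose proof (Cmod_ge_0 z). nra.
Qed.

Lemma ex_derive_g_star (z : C) : inD z -> @ex_derive C_AbsRing C_NormedModule g_star z.
Proof.
  intros Hz. exists ((1 + z * z) / ((1 - z * z) * (1 - z * z)))%C.
  pose proof (one_minus_sqr_neq_0 z Hz) as Hz0.
  unfold inD in Hz. pose proof (Cmod_ge_0 z) as Hzp.
  set (m := 1 - Cmod z).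
  assert (Hm : 0 < m) by (unfold m; lra).
  apply is_derive_C_quadratic with (m / 2) (4 * / (m / 2 * (m * m))); [lra | |].
  { apply Rmult_le_pos; [lra |]. left. apply Rinv_0_lt_compat.
    repeat apply Rmult_lt_0_compat; lra. }
  intros w Hw.
  assert (Hwm : Cmod w <= 1 - m / 2).
  { pose proof (Cmod_triangle (w - z) z) as H.
    replace (w - z + z)%C with w in H by ring. unfold m in *. lra. }
  pose proof (Cmod_ge_0 w) as Hwp.
  assert (HwD : inD w) by (unfold inD; lra).
  pose proof (one_minus_sqr_neq_0 w HwD) as Hw0.
  (* The remainder contains [(w - z)^2] as an exact factor. The cofactor has numerator at most 4 and
     a denominator bounded below through [m]. *)
  replace (g_star w - g_star z - (w - z) * ((1 + z * z) / ((1 - z * z) * (1 - z * z))))%C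
    with ((w - z) * (w - z) * (w + 2 * z + z * z * w)
          / ((1 - w * w) * ((1 - z * z) * (1 - z * z))))%C
    by (unfold g_star; field; now split).
  rewrite Cmod_div by (repeat apply Cmult_neq_0; assumption).
  rewrite !Cmod_mult.
  assert (H4 : Cmod (w + 2 * z + z * z * w) <= 4).
  { eapply Rle_trans; [apply Cmod_triangle |].
    eapply Rle_trans; [apply Rplus_le_compat_r, Cmod_triangle |].
    rewrite !Cmod_mult, Cmod_R, Rabs_pos_eq by lra.
    assert (Cmod z * Cmod z <= 1) by nra. nra. }
  assert (Hbw : m / 2 <= Cmod (1 - w * w)).
  { eapply Rle_trans; [| apply one_minus_sqr_ge]. nra. }
  assert (Hbz : m <= Cmod (1 - z * z)).
  { eapply Rle_trans; [| apply one_minus_sqr_ge]. unfold m. nra. }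
  replace (4 * / (m / 2 * (m * m)) * Cmod (w - z) ^ 2)
    with ((Cmod (w - z) * Cmod (w - z) * 4) * / (m / 2 * (m * m))) by ring.
  pose proof (Cmod_ge_0 (w - z)).
  apply Rmult_le_compat.
  - repeat apply Rmult_le_pos; apply Cmod_ge_0.
  - left. apply Rinv_0_lt_compat. repeat apply Rmult_lt_0_compat; lra.
  - apply Rmult_le_compat_l; [now apply Rmult_le_pos | exact H4].
  - apply Rinv_le_contravar; [repeat apply Rmult_lt_0_compat; lra |].
    repeat (apply Rmult_le_compat; try lra). now apply Rmult_le_pos; lra.
Qed.

Lemma Csqrt_exists (z : C) : exists d : C, (d * d)%C = z.
Proof.
  destruct z as [x y]. set (r := sqrt (x ^ 2 + y ^ 2)).
  assert (Hr : r * r = x ^ 2 + y ^ 2).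
  { apply sqrt_sqrt. pose proof (pow2_ge_0 x). pose proof (pow2_ge_0 y). lra. }
  assert (Hr0 : 0 <= r) by apply sqrt_pos.
  assert (Hx : - r <= x <= r) by (split; nra).
  set (p := sqrt ((r + x) / 2)). set (q := sqrt ((r - x) / 2)).
  assert (Hp : p * p = (r + x) / 2) by (apply sqrt_sqrt; lra).
  assert (Hq : q * q = (r - x) / 2) by (apply sqrt_sqrt; lra).
  assert (Hpq : 2 * (p * q) = Rabs y).
  { unfold p, q. rewrite <- sqrt_mult by lra.
    replace ((r + x) / 2 * ((r - x) / 2)) with (Rsqr (y / 2)).
    - rewrite sqrt_Rsqr_abs. unfold Rdiv. rewrite Rabs_mult, (Rabs_pos_eq (/ 2)) by lra. lra.
    - unfold Rsqr. nra. }
  destruct (Rle_dec 0 y) as [Hy | Hy].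
  - rewrite Rabs_pos_eq in Hpq by lra.
    exists (p, q). unfold Cmult; simpl. f_equal; lra.
  - rewrite Rabs_left in Hpq by lra.
    exists (p, - q). unfold Cmult; simpl. f_equal; lra.
Qed.

(* The two roots of [c u^2 + u - c] have product [-1]. *)
Lemma koebe_odd_preimage (c : C) : c <> 0 ->
  exists u : C, u = (c * (1 - u * u))%C /\ Cmod u <= 1.
Proof.
  intros Hc. destruct (Csqrt_exists (1 + 4 * (c * c))) as [d Hd].
  assert (Hroot : forall e, (e * e = 1 + 4 * (c * c))%C ->
    ((- (1) + e) / (2 * c) = c * (1 - ((- (1) + e) / (2 * c)) * ((- (1) + e) / (2 * c))))%C).
  { intros e He.
    replace (c * (1 - (- (1) + e) / (2 * c) * ((- (1) + e) / (2 * c))))%C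
      with ((4 * (c * c) - 1 + 2 * e - e * e) / (4 * c))%C.
    - rewrite He. field. exact Hc.
    - field. exact Hc. }
  set (u1 := ((- (1) + d) / (2 * c))%C). set (u2 := ((- (1) + - d) / (2 * c))%C).
  assert (Hu : (u1 * u2 = - (1))%C).
  { unfold u1, u2.
    replace ((- (1) + d) / (2 * c) * ((- (1) + - d) / (2 * c)))%C
      with ((1 - d * d) / (4 * (c * c)))%C
      by (field; exact Hc).
    rewrite Hd. field. exact Hc. }
  assert (Hm : Cmod u1 * Cmod u2 = 1) by (rewrite <- Cmod_mult, Hu; apply Cmod_m1).
  pose proof (Cmod_ge_0 u1). pose proof (Cmod_ge_0 u2).
  destruct (Rle_dec (Cmod u1) 1) as [H1 | H1].
  - exists u1. split; [now apply Hroot | exact H1].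
  - exists u2. split; [apply Hroot; rewrite <- Hd; ring | nra].
Qed.

(** The image is the plane without the two rays of the imaginary axis running outward from [i/2] and
    [-i/2], the values on the unit circle. The argument works with preimages: a root of the
    quadratic for [t * g_star z] lies in the closed disc, and the circle is then excluded. *)
Lemma starlike_g_star : starlike g_star.
Proof.
  split; [exact ex_derive_g_star |]. split; [| split].
  - intros z w Hz Hw H.
    pose proof (one_minus_sqr_neq_0 z Hz) as Hz0. pose proof (one_minus_sqr_neq_0 w Hw) as Hw0.
    (* Clearing denominators in [g z = g w] leaves this product, and [|z w| < 1] makes the second
       factor nonzero. *)
    assert (E : ((z - w) * (1 + z * w))%C = 0).
    { replace ((z - w) * (1 + z * w))%C
        with ((g_star z - g_star w) * ((1 - z * z) * (1 - w * w)))%C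
        by (unfold g_star; field; now split).
      rewrite H. ring. }
    destruct (Ceq_dec (z - w) 0) as [E0 | E0].
    + replace z with (z - w + w)%C by ring. rewrite E0. ring.
    + exfalso. apply (Cmult_neq_0 _ (1 + z * w) E0); [clear E; intros E | exact E].
      assert (E1 : (z * w)%C = (- (1))%C).
      { replace (z * w)%C with (1 + z * w - 1)%C by ring. rewrite E. ring. }
      apply (f_equal Cmod) in E1. rewrite Cmod_mult, Cmod_m1 in E1.
      unfold inD in *. pose proof (Cmod_ge_0 z). pose proof (Cmod_ge_0 w). nra.
  - exists (RtoC 0). split; [unfold inD; rewrite Cmod_0; lra |].
    unfold g_star, Cdiv. ring.
  - intros z t Hz Ht. set (c := (t * g_star z)%C).
    destruct (Ceq_dec c 0) as [Hc | Hc].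
    { exists (RtoC 0). split; [unfold inD; rewrite Cmod_0; lra |].
      rewrite Hc. unfold g_star, Cdiv. ring. }
    destruct (koebe_odd_preimage c Hc) as (u & Hu & [Hlt | H1]).
    { exists u. split; [exact Hlt |].
      pose proof (one_minus_sqr_neq_0 u Hlt) as Hu0.
      unfold g_star. rewrite Hu at 1. field. exact Hu0. }
    (* A root [u] on the unit circle would give [1 - z^2 = - 2 i t (Im u) z],
       which has no solution in the open disc. *)
    exfalso.
    pose proof (one_minus_sqr_neq_0 z Hz) as Hz0.
    assert (Huu : (u * Cconj u)%C = 1).
    { rewrite <- Cmod2_conj, H1. apply injective_projections; simpl; ring. }
    assert (Ec : (c * (1 - z * z) = t * z)%C) by (unfold c, g_star; field; exact Hz0).
    assert (E : (t * z * (Cconj u - u) = 1 - z * z)%C).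
    { replace (1 - z * z)%C with (u * Cconj u * (1 - z * z))%C by (rewrite Huu; ring).
      rewrite Hu at 3.
      replace (c * (1 - u * u) * Cconj u * (1 - z * z))%C
        with (c * (1 - z * z) * (Cconj u - u * (u * Cconj u)))%C by ring.
      rewrite Ec, Huu. ring. }
    apply Cmod_lt_1_sqr in Hz.
    assert (Hq : Re u ^ 2 + Im u ^ 2 = 1) by (rewrite <- Cmod2_alt, H1; ring).
    destruct z as [a b], u as [p q]. simpl in Hz, Hq.
    injection E. simpl. intros Eim Ere.
    assert (Hs : - 1 <= t * q <= 1) by (split; nra).
    set (s := t * q) in *.
    assert (Eim' : a * (b - s) = 0) by (unfold s; nra).
    assert (Ere' : a * a - b * b + 2 * s * b - 1 = 0) by (unfold s; nra).
    destruct (Rmult_integral _ _ Eim') as [Ha | Hb].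
    + subst a.
      assert (Hb : 0 < (1 - b) ^ 2 /\ 0 < (1 + b) ^ 2) by (split; apply pow_lt; nra).
      (* For [|s| <= 1] this is a convex combination of two positive squares, so it cannot
         vanish. *)
      assert (1 + b * b - 2 * s * b = (1 + s) / 2 * (1 - b) ^ 2 + (1 - s) / 2 * (1 + b) ^ 2)
        by field.
      destruct Hb as [Hb1 Hb2]. set (A := (1 - b) ^ 2) in *. set (B := (1 + b) ^ 2) in *.
      assert (0 <= (1 + s) / 2 * A) by (apply Rmult_le_pos; lra).
      assert (0 <= (1 - s) / 2 * B) by (apply Rmult_le_pos; lra).
      destruct (Rlt_dec s 0); nra.
    (* With [s = b] the real part reads [a^2 + b^2 = 1], against [|z| < 1]. *)
    + replace s with b in Ere' by lra. nra.
Qed.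

(** * Complex power series *)

Lemma Rabs_Re_pow_le (z : C) (n : nat) : Cmod z <= 1 -> Rabs (Re (z ^ n)) <= 1.
Proof.
  intros Hz. apply Rle_trans with (1 := re_le_Cmod _). rewrite Cmod_pow.
  rewrite <- (pow1 n). apply pow_incr. split; [apply Cmod_ge_0 | exact Hz].
Qed.

(** The disc version of [|sin (n theta)| <= n |sin theta|], by the same addition-formula
    induction. *)
Lemma Rabs_Im_pow_le (z : C) (n : nat) : Cmod z <= 1 ->
  Rabs (Im (z ^ n)) <= INR n * Rabs (Im z).
Proof.
  intros Hz. induction n as [| n IH].
  - simpl. rewrite Rabs_R0. lra.
  - rewrite Cpow_S, im_mult, S_INR.
    eapply Rle_trans; [apply Rabs_triang |]. rewrite !Rabs_mult.
    pose proof (Rabs_Re_pow_le z n Hz) as H1. pose proof (re_le_Cmod z) as H2.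
    pose proof (Rabs_pos (Im z)). pose proof (Rabs_pos (Re z)).
    pose proof (Rabs_pos (Im (z ^ n))). nra.
Qed.

(* The real part is [(1 - |z|^2) Re (z^n) + 2 (Im z) (Im (z^(n+1)))]. *)
Lemma Rabs_Re_one_minus_sqr_mult_pow_le (z : C) (n : nat) : Cmod z <= 1 ->
  Rabs (Re ((1 - z * z) * z ^ n)) <= (INR n + 1) * Re (1 - z * z).
Proof.
  intros Hz.
  assert (Hz2 : Re z ^ 2 + Im z ^ 2 <= 1).
  { rewrite <- Cmod2_alt. pose proof (Cmod_ge_0 z). nra. }
  assert (E : Re ((1 - z * z) * z ^ n)
    = (1 - (Re z ^ 2 + Im z ^ 2)) * Re (z ^ n) + 2 * Im z * Im (z ^ S n)).
  { rewrite Cpow_S. destruct z as [x y], ((x, y) ^ n)%C as [p q]. simpl. ring. }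
  (* Both sides now split into a [1 - |z|^2] part and an [Im z] part, compared separately. *)
  assert (E1 : Re (1 - z * z) = (1 - (Re z ^ 2 + Im z ^ 2)) + 2 * Rabs (Im z) ^ 2).
  { rewrite pow2_abs. destruct z as [x y]. simpl. ring. }
  rewrite E, E1.
  pose proof (Rabs_Im_pow_le z (S n) Hz) as H1. rewrite S_INR in H1.
  pose proof (Rabs_Re_pow_le z n Hz) as H2.
  set (k := 1 - (Re z ^ 2 + Im z ^ 2)) in *.
  assert (Hk : 0 <= k) by (unfold k; lra).
  eapply Rle_trans; [apply Rabs_triang |]. rewrite !Rabs_mult.
  rewrite (Rabs_pos_eq k) by exact Hk. rewrite (Rabs_pos_eq 2) by lra.
  pose proof (pos_INR n). pose proof (Rabs_pos (Im z)).
  assert (k * Rabs (Re (z ^ n)) <= (INR n + 1) * k) by nra.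
  assert (2 * Rabs (Im z) * Rabs (Im (z ^ S n))
          <= 2 * Rabs (Im z) * ((INR n + 1) * Rabs (Im z))).
  { apply Rmult_le_compat_l; lra. }
  nra.
Qed.

(** The next remainder is [w] times the present one plus [(n + 1) z^n (w - z)^2], and
    [(n + 1)^2 + (n + 1) <= (n + 2)^2]. *)
Lemma Cmod_pow_taylor_le (z w : C) (n : nat) : Cmod z <= 1 -> Cmod w <= 1 ->
  Cmod (w ^ S n - z ^ S n - (w - z) * (INR (S n) * z ^ n))
  <= (INR n + 1) ^ 2 * Cmod (w - z) ^ 2.
Proof.
  intros Hz Hw. pose proof (pow2_ge_0 (Cmod (w - z))) as Hs.
  induction n as [| n IH].
  - replace (w ^ 1 - z ^ 1 - (w - z) * (INR 1 * z ^ 0))%C with (RtoC 0) by (simpl; ring).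
    rewrite Cmod_0. simpl INR. lra.
  - replace (w ^ S (S n) - z ^ S (S n) - (w - z) * (INR (S (S n)) * z ^ S n))%C
      with (w * (w ^ S n - z ^ S n - (w - z) * (INR (S n) * z ^ n))
            + INR (S n) * z ^ n * (w - z) ^ 2)%C.
    2: { rewrite (S_INR (S n)), RtoC_plus, !Cpow_S. ring. }
    eapply Rle_trans; [apply Cmod_triangle |].
    rewrite !Cmod_mult, !Cmod_pow, Cmod_R, Rabs_pos_eq by apply pos_INR.
    set (e := Cmod (w ^ S n - z ^ S n - (w - z) * (INR (S n) * z ^ n))) in *.
    assert (He : 0 <= e) by apply Cmod_ge_0.
    assert (Hzn : Cmod z ^ n <= 1).
    { rewrite <- (pow1 n). apply pow_incr. split; [apply Cmod_ge_0 | exact Hz]. }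
    rewrite S_INR. pose proof (pos_INR n) as Hn.
    set (s := Cmod (w - z) ^ 2) in *.
    pose proof (Cmod_ge_0 w).
    assert (Cmod w * e <= 1 * e) by (apply Rmult_le_compat_r; lra).
    assert ((INR n + 1) * Cmod z ^ n * s <= (INR n + 1) * 1 * s).
    { apply Rmult_le_compat_r; [exact Hs |]. apply Rmult_le_compat_l; lra. }
    nra.
Qed.

Lemma pow_n_Cpow (z : C) (n : nat) : @pow_n C_Ring z n = (z ^ n)%C.
Proof. induction n as [| n IH]; [reflexivity | simpl; rewrite IH; reflexivity]. Qed.

Lemma sum_n_Re (u : nat -> C) (n : nat) :
  Re (@sum_n C_AbelianMonoid u n) = sum_n (fun k => Re (u k)) n.
Proof.
  induction n as [| n IH]; [now rewrite !sum_O |].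
  rewrite !sum_Sn. simpl. now rewrite <- IH.
Qed.

Lemma sum_n_Im (u : nat -> C) (n : nat) :
  Im (@sum_n C_AbelianMonoid u n) = sum_n (fun k => Im (u k)) n.
Proof.
  induction n as [| n IH]; [now rewrite !sum_O |].
  rewrite !sum_Sn. simpl. now rewrite <- IH.
Qed.

Lemma is_series_Re (u : nat -> C) (l : C) :
  @is_series C_AbsRing C_NormedModule u l -> is_series (fun n => Re (u n)) (Re l).
Proof.
  intros H. apply (filterlim_ext (fun n => Re (@sum_n C_AbelianMonoid u n))); [apply sum_n_Re |].
  apply filterlim_locally. intros eps.
  generalize (proj1 (filterlim_locally _ _) H eps). apply filter_imp.
  intros n [Hn _]. exact Hn.
Qed.

Lemma is_series_Im (u : nat -> C) (l : C) :
  @is_series C_AbsRing C_NormedModule u l -> is_series (fun n => Im (u n)) (Im l).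
Proof.
  intros H. apply (filterlim_ext (fun n => Im (@sum_n C_AbelianMonoid u n))); [apply sum_n_Im |].
  apply filterlim_locally. intros eps.
  generalize (proj1 (filterlim_locally _ _) H eps). apply filter_imp.
  intros n [_ Hn]. exact Hn.
Qed.

Lemma is_series_C_unique (u : nat -> C) (l1 l2 : C) :
  @is_series C_AbsRing C_NormedModule u l1 -> @is_series C_AbsRing C_NormedModule u l2 ->
  l1 = l2.
Proof.
  intros H1 H2. apply injective_projections.
  - transitivity (Series (fun n => Re (u n))).
    + symmetry. apply is_series_unique, (is_series_Re _ _ H1).
    + apply is_series_unique, (is_series_Re _ _ H2).
  - transitivity (Series (fun n => Im (u n))).
    + symmetry. apply is_series_unique, (is_series_Im _ _ H1).
    + apply is_series_unique, (is_series_Im _ _ H2).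
Qed.

Lemma Rabs_is_series_le (a M : nat -> R) (l L : R) :
  (forall n, Rabs (a n) <= M n) -> is_series a l -> is_series M L -> Rabs l <= L.
Proof.
  intros Ha Hl HL.
  assert (Hex : ex_series (fun n => Rabs (a n))).
  { apply (ex_series_le (V := R_CompleteNormedModule)) with M.
    - intros n. unfold norm; simpl. unfold abs; simpl. rewrite Rabs_Rabsolu. apply Ha.
    - now exists L. }
  rewrite <- (is_series_unique _ _ Hl), <- (is_series_unique _ _ HL).
  apply Rle_trans with (1 := Series_Rabs _ Hex).
  apply Series_le; [| now exists L]. intros n. split; [apply Rabs_pos | apply Ha].
Qed.

(** The factor 2 comes from bounding real and imaginary parts separately; it only enlarges the
    constant of a quadratic remainder. *)
Lemma Cmod_is_series_le (u : nat -> C) (M : nat -> R) (l : C) (L : R) :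
  (forall n, Cmod (u n) <= M n) ->
  @is_series C_AbsRing C_NormedModule u l -> is_series M L -> Cmod l <= 2 * L.
Proof.
  intros Hu Hl HL.
  assert (H1 : Rabs (Re l) <= L).
  { apply (Rabs_is_series_le (fun n => Re (u n)) M); [| now apply is_series_Re | exact HL].
    intros n. apply Rle_trans with (2 := Hu n). apply re_le_Cmod. }
  assert (H2 : Rabs (Im l) <= L).
  { apply (Rabs_is_series_le (fun n => Im (u n)) M); [| now apply is_series_Im | exact HL].
    intros n. apply Rle_trans with (2 := Hu n).
    apply Rle_trans with (2 := Rmax_Cmod _). apply Rmax_r. }
  replace l with (RtoC (Re l) + Ci * RtoC (Im l))%C
    by (destruct l as [x y]; apply injective_projections; simpl; ring).
  apply Rle_trans with (1 := Cmod_triangle _ _).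
  rewrite Cmod_mult, !Cmod_R, Cmod_Ci. lra.
Qed.

(** * Convergence and termwise differentiation of [z B_nu(z)] *)

Lemma ex_series_bs_coef (nu : R) : 64 <= PI * (nu + 1) ->
  ex_series (fun n => (INR n + 1) ^ 2 * bs_coef nu n).
Proof.
  intros H64. pose proof PI_RGT_0. pose proof PI_4.
  apply (ex_series_le (V := R_CompleteNormedModule)) with (fun n => 3 / 2 * (3 / 8) ^ n).
  - intros n. unfold norm; simpl. unfold abs; simpl.
    rewrite Rabs_pos_eq; [now apply bs_coef_geom_le |].
    apply Rmult_le_pos; [apply pow2_ge_0 | left; apply bs_coef_pos; nra].
  - exists (3 / 2 * / (1 - 3 / 8)).
    apply (is_series_scal (V := R_NormedModule) (3 / 2)).
    apply is_series_geom. rewrite Rabs_pos_eq; lra.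
Qed.

Lemma is_series_of_bs_coef_bound (nu : R) (u : nat -> C) : 64 <= PI * (nu + 1) ->
  (forall n, Cmod (u n) <= (INR n + 1) ^ 2 * bs_coef nu n) ->
  exists l, @is_series C_AbsRing C_NormedModule u l.
Proof.
  intros H64 Hu.
  apply (ex_series_le (K := C_AbsRing) (V := C_CompleteNormedModule))
    with (fun n => (INR n + 1) ^ 2 * bs_coef nu n).
  - exact Hu.
  - now apply ex_series_bs_coef.
Qed.

Lemma bs_f_series (nu : R) (z : C) : 64 <= PI * (nu + 1) -> Cmod z <= 1 ->
  @is_series C_AbsRing C_NormedModule (fun n => RtoC (bs_coef nu n) * z ^ S n)%C (bs_f nu z).
Proof.
  intros H64 Hz. pose proof PI_RGT_0. pose proof PI_4.
  assert (HBS : @is_pseries C_AbsRing C_NormedModule (fun n => RtoC (bs_coef nu n)) z (BS nu z)).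
  { unfold BS.
    apply (iota_correct (V := C_CompleteNormedModule)
      (fun l => @is_pseries C_AbsRing C_NormedModule (fun n => RtoC (bs_coef nu n)) z l)).
    destruct (is_series_of_bs_coef_bound nu
      (fun n => scal (@pow_n C_Ring z n) (RtoC (bs_coef nu n))) H64) as [l Hl].
    - intros n. rewrite pow_n_Cpow.
      change (Cmod (z ^ n * RtoC (bs_coef nu n)) <= (INR n + 1) ^ 2 * bs_coef nu n).
      pose proof (bs_coef_pos nu n ltac:(nra)) as Hb.
      rewrite Cmod_mult, Cmod_R, Cmod_pow, (Rabs_pos_eq (bs_coef nu n)) by lra.
      apply Rmult_le_compat_r; [lra |]. apply Rle_trans with 1.
      + rewrite <- (pow1 n). apply pow_incr. split; [apply Cmod_ge_0 | exact Hz].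
      + pose proof (pos_INR n). nra.
    - exists l. split; [exact Hl |]. intros l' Hl'. exact (is_series_C_unique _ _ _ Hl Hl'). }
  apply (is_series_ext (V := C_NormedModule)
    (fun n => scal z (scal (@pow_n C_Ring z n) (RtoC (bs_coef nu n))))).
  - intros n. rewrite pow_n_Cpow, Cpow_S.
    change ((z * (z ^ n * RtoC (bs_coef nu n)))%C = (RtoC (bs_coef nu n) * (z * z ^ n))%C). ring.
  - exact (is_series_scal (K := C_AbsRing) (V := C_NormedModule) z _ _ HBS).
Qed.

(** Summing the Taylor remainders of the monomials against [b_n] gives at most [2 L |w - z|^2],
    where [L] is the sum of [(n + 1)^2 b_n]. *)
Lemma is_derive_bs_f (nu : R) (z : C) : 64 <= PI * (nu + 1) -> inD z ->
  exists l, @is_derive C_AbsRing C_NormedModule (bs_f nu) z l /\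
    @is_series C_AbsRing C_NormedModule
      (fun n => RtoC (bs_coef nu n) * (INR (S n) * z ^ n))%C l.
Proof.
  intros H64 Hz. pose proof PI_RGT_0. pose proof PI_4.
  assert (Hb : forall n, 0 < bs_coef nu n) by (intros; apply bs_coef_pos; nra).
  destruct (is_series_of_bs_coef_bound nu
      (fun n => RtoC (bs_coef nu n) * (INR (S n) * z ^ n))%C H64) as [l Hl].
  { intros n. rewrite !Cmod_mult, !Cmod_R, Cmod_pow, S_INR.
    specialize (Hb n). pose proof (pos_INR n).
    rewrite !Rabs_pos_eq by lra.
    rewrite (Rmult_comm ((INR n + 1) ^ 2)). apply Rmult_le_compat_l; [lra |].
    assert (Cmod z ^ n <= 1).
    { rewrite <- (pow1 n). apply pow_incr. split; [apply Cmod_ge_0 | unfold inD in Hz; lra]. }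
    nra. }
  exists l. split; [| exact Hl].
  destruct (ex_series_bs_coef nu H64) as [L HL].
  assert (HL0 : 0 <= L).
  { rewrite <- (is_series_unique _ _ HL), <- (is_series_unique (fun _ : nat => 0) 0).
    - apply Series_le; [| now exists L]. intros n. split; [lra |].
      apply Rmult_le_pos; [apply pow2_ge_0 | left; apply Hb].
    - apply (filterlim_ext (fun _ => 0)); [| apply filterlim_const].
      intros n. rewrite sum_n_const. ring. }
  unfold inD in Hz.
  apply is_derive_C_quadratic with (1 - Cmod z) (2 * L); [lra | lra |].
  intros w Hw.
  assert (Hw1 : Cmod w <= 1).
  { pose proof (Cmod_triangle (w - z) z) as H1.
    replace (w - z + z)%C with w in H1 by ring. lra. }
  assert (Hd : @is_series C_AbsRing C_NormedModule
    (fun n => RtoC (bs_coef nu n)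
       * (w ^ S n - z ^ S n - (w - z) * (INR (S n) * z ^ n)))%C
    (bs_f nu w - bs_f nu z - (w - z) * l)%C).
  { apply (is_series_ext (V := C_NormedModule) (fun n => minus (minus
       (RtoC (bs_coef nu n) * w ^ S n)%C (RtoC (bs_coef nu n) * z ^ S n)%C)
       (scal (w - z)%C (RtoC (bs_coef nu n) * (INR (S n) * z ^ n))%C))).
    - intros n.
      change ((RtoC (bs_coef nu n) * w ^ S n - RtoC (bs_coef nu n) * z ^ S n
         - (w - z) * (RtoC (bs_coef nu n) * (INR (S n) * z ^ n)))%C
         = (RtoC (bs_coef nu n) * (w ^ S n - z ^ S n - (w - z) * (INR (S n) * z ^ n)))%C).
      ring.
    - apply (is_series_minus (V := C_NormedModule)).
      + apply (is_series_minus (V := C_NormedModule)); apply bs_f_series; lra.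
      + apply (is_series_scal (V := C_NormedModule)). exact Hl. }
  replace (2 * L * Cmod (w - z) ^ 2) with (2 * (L * Cmod (w - z) ^ 2)) by ring.
  apply (Cmod_is_series_le _ (fun n => (INR n + 1) ^ 2 * bs_coef nu n * Cmod (w - z) ^ 2) _ _)
    with (2 := Hd).
  - intros n. rewrite Cmod_mult, Cmod_R, Rabs_pos_eq by (left; apply Hb).
    rewrite (Rmult_comm ((INR n + 1) ^ 2)), Rmult_assoc.
    apply Rmult_le_compat_l; [left; apply Hb |]. apply Cmod_pow_taylor_le; lra.
  - now apply (is_series_scal_r (Cmod (w - z) ^ 2)).
Qed.

(** * Positivity of [Re ((1 - z^2) f'(z))] and close-to-convexity *)

Lemma is_series_nonneg_ge_0th (a : nat -> R) (l : R) :
  (forall n, 0 <= a n) -> is_series a l -> a 0%nat <= l.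
Proof.
  intros Ha Hl.
  apply (is_lim_seq_le (fun _ => a 0%nat) (sum_n a) (a 0%nat) l).
  - intros n. induction n as [| n IH]; [rewrite sum_O; lra |].
    rewrite sum_Sn. unfold plus; simpl. specialize (Ha (S n)). lra.
  - apply is_lim_seq_const.
  - exact Hl.
Qed.

(* The terms with [n >= 1] are at most [3/2 * (3/8)^n] times the zeroth one,
   and [3/2 * sum_(n >= 1) (3/8)^n = 9/10 < 1]. *)
Lemma Re_one_minus_sqr_mult_deriv_pos (nu : R) (z l : C) :
  64 <= PI * (nu + 1) -> inD z ->
  @is_series C_AbsRing C_NormedModule
      (fun n => RtoC (bs_coef nu n) * (INR (S n) * z ^ n))%C l ->
  0 < Re ((1 - z * z) * l).
Proof.
  intros H64 Hz Hl. pose proof PI_RGT_0. pose proof PI_4.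
  assert (Hb : forall n, 0 < bs_coef nu n) by (intros; apply bs_coef_pos; nra).
  set (rho := Re (1 - z * z)).
  assert (Hrho : 0 < rho).
  { apply Cmod_lt_1_sqr in Hz. unfold rho. destruct z as [x y]. simpl in *.
    pose proof (pow2_ge_0 y). nra. }
  pose (t := fun n => bs_coef nu n * (INR n + 1) * Re ((1 - z * z) * z ^ n)).
  assert (Ht : is_series t (Re ((1 - z * z) * l))).
  { apply (is_series_ext (fun n => Re (scal (1 - z * z)%C
        (RtoC (bs_coef nu n) * (INR (S n) * z ^ n))%C : C))).
    - intros n. unfold t.
      change (Re ((1 - z * z) * (RtoC (bs_coef nu n) * (INR (S n) * z ^ n)))
        = bs_coef nu n * (INR n + 1) * Re ((1 - z * z) * z ^ n)).
      rewrite <- S_INR, <- re_scal_l, RtoC_mult. f_equal. ring.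
    - apply (is_series_Re (fun n => scal (1 - z * z)%C _)).
      apply (is_series_scal (V := C_NormedModule)). exact Hl. }
  assert (Hgeom : is_series (fun n => 3 / 2 * rho * (3 / 8) ^ n) (12 / 5 * rho)).
  { replace (12 / 5 * rho) with (3 / 2 * rho * / (1 - 3 / 8)) by field.
    apply (is_series_scal (V := R_NormedModule) (3 / 2 * rho)). apply is_series_geom.
    rewrite Rabs_pos_eq; lra. }
  assert (Ht0 : t 0%nat = rho).
  { unfold t. rewrite bs_coef_0 by nra. simpl INR.
    replace ((1 - z * z) * z ^ 0)%C with (1 - z * z)%C by (simpl; ring).
    fold rho. ring. }
  (* Adding the geometric majorant, zeroth term included, makes every term nonnegative. Comparing
     the zeroth term with the sum leaves [(1 + 3/2 - 12/5) rho = rho / 10]. *)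
  enough (Hpos : forall n, 0 <= t n + 3 / 2 * rho * (3 / 8) ^ n).
  { pose proof (is_series_nonneg_ge_0th _ _ Hpos (is_series_plus _ _ _ _ Ht Hgeom)) as H1.
    change (t 0%nat + 3 / 2 * rho * 1 <= Re ((1 - z * z) * l) + 12 / 5 * rho) in H1.
    rewrite Ht0 in H1. lra. }
  intros n.
  enough (Habs : Rabs (t n) <= 3 / 2 * rho * (3 / 8) ^ n).
  { pose proof (Rle_abs (- t n)) as Hneg. rewrite Rabs_Ropp in Hneg. lra. }
  unfold t. specialize (Hb n). pose proof (pos_INR n).
  rewrite Rabs_mult, Rabs_pos_eq by nra.
  pose proof (Rabs_Re_one_minus_sqr_mult_pow_le z n ltac:(unfold inD in Hz; lra)) as HRe.
  fold rho in HRe.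
  apply Rle_trans with ((INR n + 1) ^ 2 * bs_coef nu n * rho).
  - replace ((INR n + 1) ^ 2 * bs_coef nu n * rho)
      with (bs_coef nu n * (INR n + 1) * ((INR n + 1) * rho)) by ring.
    apply Rmult_le_compat_l; [nra | exact HRe].
  - replace (3 / 2 * rho * (3 / 8) ^ n) with (3 / 2 * (3 / 8) ^ n * rho) by ring.
    apply Rmult_le_compat_r; [lra |]. now apply bs_coef_geom_le.
Qed.

Theorem theorem4 (nu0 nu : R) :
  0 < nu0 ->
  sqrt PI * Gamma (nu0 + 3 / 2) = 8 * Gamma (nu0 + 1) ->
  nu0 <= nu ->
  close_to_convex_wrt (bs_f nu) g_star.
Proof.
  intros H0 Heq Hle.
  assert (H64 : 64 <= PI * (nu + 1)).
  { pose proof (Gamma_ratio_root_ge nu0 H0 Heq). pose proof PI_RGT_0. nra. }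
  assert (HD0 : inD 0) by (unfold inD; rewrite Cmod_0; lra).
  split; [| split; [exact starlike_g_star |]].
  - split; [| split].
    + intros z Hz. destruct (is_derive_bs_f nu z H64 Hz) as (l & Hl & _). now exists l.
    + apply Cmult_0_l.
    + destruct (is_derive_bs_f nu 0 H64 HD0) as (l & Hl & Hs).
      replace (RtoC 1) with l; [exact Hl |].
      apply (is_series_C_unique _ _ _ Hs).
      (* At [z = 0] every partial sum of the derivative series equals [b_0 = 1]. *)
      apply (filterlim_ext (fun _ => RtoC 1)); [| apply filterlim_const].
      intros n. induction n as [| n IH].
      * rewrite sum_O, bs_coef_0 by lra. simpl. ring.
      * rewrite sum_Sn, <- IH, Cpow_S.
        change (RtoC 1 = (1 + RtoC (bs_coef nu (S n)) * (INR (S (S n)) * (0 * 0 ^ n)))%C).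
        ring.
  - exists 0. intros z Hz Hz0 df Hdf.
    destruct (is_derive_bs_f nu z H64 Hz) as (l & Hl & Hs).
    replace df with l.
    2: { rewrite <- (is_C_derive_unique _ _ _ Hl). now apply is_C_derive_unique. }
    pose proof (one_minus_sqr_neq_0 z Hz) as Hq.
    replace ((cos 0, sin 0) * (z * l / g_star z))%C with ((1 - z * z) * l)%C.
    + now apply (Re_one_minus_sqr_mult_deriv_pos nu).
    + rewrite cos_0, sin_0. change (1, 0) with (RtoC 1).
      unfold g_star. field. now split.
Qed.
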